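(* Assume that $X$ is a dart taking values in $\mathbb{R}^n$ with an absolutely continuous law $\mu_X$ and that $f$ is a bounded payoff function on $\mathbb{R}^n$ such that $(X,f)$ is not reasonable. Then there exists a nonnegative continuous payoff function $h$ with compact support on $\mathbb{R}^n$ such that $(X,h)$ is not reasonable.
   Context: A dart is a random vector $X$ taking values in $\mathbb{R}^n$. Absolute continuity is with respect to Lebesgue measure. A payoff function is a measurable function $f:\mathbb{R}^n\to\mathbb{R}$ bounded from above. For $d>0$, $g_{X,f}(d):=\sup_{a\in\mathbb{R}^n}Ef(a+dX)$. The pair $(X,f)$ is reasonable if $g_{X,f}(d)$ is decreasing (i.e. non-increasing) in $d\in(0,\infty)$. *)

(* Defs.v *)
From HB Require Import structures.
From mathcomp Require Import all_boot all_order all_algebra.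
From mathcomp Require Import all_classical all_reals all_analysis measurable_realfun.

Set Implicit Arguments.
Unset Strict Implicit.
Unset Printing Implicit Defensive.

Import Order.TTheory GRing.Theory Num.Theory.
Import numFieldNormedType.Exports.

Local Open Scope classical_set_scope.
Local Open Scope ring_scope.

(* R^n is 'rV[R]_n, with the Borel sigma-algebra of its (product) topology. *)
Section borel_rV.
Context (R : realType) (n : nat).

HB.instance Definition _ := @isMeasurable.Build
  (sigma_display (@open 'rV[R]_n)) 'rV[R]_n <<s @open 'rV[R]_n >>
  (@sigma_algebra0 _ setT _) (@sigma_algebraC _ _)
  (@sigma_algebra_bigcup _ setT _).

End borel_rV.

Section measurable_rV.
Context (R : realType).

Lemma measurable_rV_open n (U : set 'rV[R]_n) : open U -> measurable U.
Proof. exact: sub_sigma_algebra. Qed.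

Lemma measurable_coord_rV n (i : 'I_n) :
  measurable_fun setT (fun v : 'rV[R]_n => v ord0 i).
Proof.
apply: (measurability _ (RGenOInfty.measurableE R)).
move=> _ [_ [a ->] <-]; rewrite setTI; apply: measurable_rV_open.
by apply: open_comp; [move=> v _; exact: coord_continuous|exact: interval_open].
Qed.

Lemma open_rV_ratE n (U : set 'rV[R]_n) : open U ->
  U = \bigcup_(p in [set p : 'rV[rat]_n * rat |
         ball (map_mx ratr p.1 : 'rV[R]_n) (ratr p.2) `<=` U])
      ball (map_mx ratr p.1 : 'rV[R]_n) (ratr p.2).
Proof.
move=> oU; apply/seteqP; split=> [v Uv|v [p pU pv]]; last exact: pU.
have /nbhs_ballP[e /= e0 veU] : nbhs v U by exact: open_nbhs_nbhs.
have [r] := rat_in_itvoo (divr_gt0 e0 (ltr0n R 2)).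
rewrite in_itv/= => /andP[r0 re].
have q_ i : {q : rat | ball (v ord0 i) (ratr r) (ratr q : R)}.
  apply: cid.
  have lt : v ord0 i - ratr r < v ord0 i + ratr r by rewrite ltrD2l gtrN.
  have [q] := rat_in_itvoo lt; rewrite in_itv/= => /andP[q1 q2].
  exists q; rewrite /ball/= ltr_distlC; apply/andP; split=> //.
pose q : 'rV[rat]_n := \row_i sval (q_ i).
have vq : ball v (ratr r) (map_mx ratr q : 'rV[R]_n).
  by split=> // i j; rewrite ord1 !mxE; exact: svalP (q_ j).
exists (q, r) => /=; last exact: ball_sym.
move=> w qw; apply: veU; apply: (le_ball _ (ball_triangle vq qw)).
by rewrite (splitr e) lerD// ltW.
Qed.

Lemma measurable_fun_rV d (T : measurableType d) n (f : T -> 'rV[R]_n) :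
  (forall i, measurable_fun setT (fun t => f t ord0 i)) ->
  measurable_fun setT f.
Proof.
move=> mf; apply: (@measurability _ _ _ _ _ _ (@open 'rV[R]_n)) => //.
move=> _ [U oU <-]; rewrite (open_rV_ratE oU) preimage_bigcup setTI bigcup_mkcond.
apply: countable_bigcupT_measurable => // -[q r] /=.
case: ifPn => // _; have [r0|r0] := leP (ratr r : R) 0.
  rewrite (_ : _ @^-1` _ = set0)//; apply/seteqP; split=> // t [/=].
  by rewrite ltNge r0.
rewrite (_ : _ @^-1` _ = \bigcap_(i : 'I_n)
    ((fun t => f t ord0 i) @^-1` ball (ratr (q ord0 i) : R) (ratr r))).
  apply: fin_bigcap_measurable => // i _; rewrite -[X in measurable X]setTI.
  by apply: mf => //; apply: open_measurable; exact: ball_open.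
apply/seteqP; split=> t /=.
  by move=> [_ qt] i _ /=; move: (qt ord0 i); rewrite mxE.
by move=> qt; split=> // i j; rewrite ord1 mxE; exact: qt.
Qed.

End measurable_rV.

(* n-dimensional Lebesgue measure, as the n-fold product of the Lebesgue
   measure on R, transported along R * R^n ~ R^(1 + n). *)
Section lebesgue_rV.
Context (R : realType).

Definition cons_rV n (p : measurableTypeR R * 'rV[R]_n) : 'rV[R]_n.+1 :=
  row_mx (p.1%:M : 'rV[R]_1) p.2.

Definition uncons_rV n (v : 'rV[R]_n.+1) : measurableTypeR R * 'rV[R]_n :=
  (v ord0 ord0, \row_i v ord0 (lift ord0 i)).

Lemma cons_rVK n : cancel (@cons_rV n) (@uncons_rV n).
Proof.
move=> [x v]; rewrite /uncons_rV /cons_rV/=; congr pair.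
  have -> : ord0 = lshift n (ord0 : 'I_1) :> 'I_(1 + n) by exact: val_inj.
  by rewrite [LHS](row_mxEl (x%:M : 'rV[R]_1) v) mxE.
apply/rowP => i; rewrite mxE.
have -> : lift ord0 i = rshift 1 i :> 'I_(1 + n) by exact: val_inj.
exact: row_mxEr.
Qed.

Lemma measurable_cons_rV n : measurable_fun setT (@cons_rV n).
Proof.
apply: measurable_fun_rV => i; rewrite /cons_rV.
have [j|j] := split_ordP (i : 'I_(1 + n)) => ->.
  apply: (eq_measurable_fun fst); last exact: measurable_fst.
  by move=> p _ /=; rewrite [RHS](row_mxEl (p.1%:M : 'rV[R]_1)) !ord1 mxE.
apply: (eq_measurable_fun (fun p : measurableTypeR R * 'rV[R]_n => p.2 ord0 j)).
  by move=> p _; rewrite [RHS](row_mxEr (p.1%:M : 'rV[R]_1)).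
exact: (measurableT_comp (measurable_coord_rV j)).
Qed.

Lemma measurable_uncons_rV n : measurable_fun setT (@uncons_rV n).
Proof.
apply/measurable_fun_pairP; split => /=; first exact: measurable_coord_rV.
apply: measurable_fun_rV => i /=; under eq_fun do rewrite mxE.
exact: measurable_coord_rV.
Qed.

Section step.
Context (n : nat) (m : {sigma_finite_measure set 'rV[R]_n -> \bar R}).

Definition lebesgue_rVS : set 'rV[R]_n.+1 -> \bar R :=
  pushforward (lebesgue_measure \x m)%E (@cons_rV n).

Let lebesgue_rVS0 : lebesgue_rVS set0 = 0%E.
Proof. by rewrite /lebesgue_rVS /pushforward preimage_set0 measure0. Qed.

Let lebesgue_rVS_ge0 A : (0 <= lebesgue_rVS A)%E.
Proof. by rewrite /lebesgue_rVS /pushforward measure_ge0. Qed.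

Let lebesgue_rVS_sigma_additive : semi_sigma_additive lebesgue_rVS.
Proof.
apply: measure_semi_sigma_additive; exact: measurable_cons_rV.
Qed.

HB.instance Definition _ := isMeasure.Build _ _ _ lebesgue_rVS
  lebesgue_rVS0 lebesgue_rVS_ge0 lebesgue_rVS_sigma_additive.

Let lebesgue_rVS_sigma_finite : sigma_finite setT lebesgue_rVS.
Proof.
have /sigma_finiteP[F [FT ndF Foo]] := sigma_finiteT (@lebesgue_measure R).
have /sigma_finiteP[G [GT ndG Goo]] := sigma_finiteT m.
have mFG k : measurable (F k `*` G k).
  by apply: measurableX; [have [] := Foo k|have [] := Goo k].
exists (fun k => @uncons_rV n @^-1` (F k `*` G k)).
  rewrite -preimage_bigcup; apply/esym/seteqP; split=> // v _.
  have [i _ Fi] : (\bigcup_k F k) (uncons_rV v).1 by rewrite -FT.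
  have [j _ Gj] : (\bigcup_k G k) (uncons_rV v).2 by rewrite -GT.
  exists (maxn i j) => //; split.
    by move: Fi; exact/subsetPset/ndF/leq_maxl.
  by move: Gj; exact/subsetPset/ndG/leq_maxr.
move=> k; split.
  by rewrite -[X in measurable X]setTI; exact: measurable_uncons_rV.
rewrite /lebesgue_rVS /pushforward -comp_preimage.
rewrite (_ : _ \o _ = id); last by apply/funext => p /=; exact: cons_rVK.
have [? ?] := Foo k; have [? ?] := Goo k.
by rewrite preimage_id product_measure1E// lte_mul_pinfty// ge0_fin_numE.
Qed.

HB.instance Definition _ := Measure_isSigmaFinite.Build _ _ _ lebesgue_rVS
  lebesgue_rVS_sigma_finite.

End step.

Fixpoint lebesgue_rV n : {sigma_finite_measure set 'rV[R]_n -> \bar R} :=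
  if n is k.+1 then lebesgue_rVS (lebesgue_rV k) else \d_(0 : 'rV[R]_0).

Lemma lebesgue_rV_box n (A : 'I_n -> set (measurableTypeR R)) :
  (forall i, measurable (A i)) ->
  lebesgue_rV n [set v | forall i, A i (v ord0 i)] =
  (\prod_(i < n) lebesgue_measure (A i))%E.
Proof.
elim: n A => [|n IH] A mA; first by rewrite big_ord0/= diracE mem_set// => -[].
have mB : measurable [set v : 'rV[R]_n | forall i, A (lift ord0 i) (v ord0 i)].
  rewrite (_ : [set _ | _] = \bigcap_(i : 'I_n)
      ((fun v : 'rV[R]_n => v ord0 i) @^-1` A (lift ord0 i))).
    apply: fin_bigcap_measurable => // i _; rewrite -[X in measurable X]setTI.
    exact: (measurable_coord_rV i measurableT (mA (lift ord0 i))).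
  by apply/seteqP; split=> v /= Av i => [_|]; exact: Av.
rewrite big_ord_recl -IH// -[RHS]product_measure1E//=.
rewrite /lebesgue_rVS /pushforward; congr (_ _); apply/seteqP.
split=> -[x v] /= Av; have := cons_rVK (x, v); rewrite /uncons_rV => -[xE vE].
  split=> [|i]; first by rewrite -xE; exact: Av.
  by rewrite -vE mxE; exact: Av.
move=> i; have [j ->|->] := unliftP ord0 i; last by rewrite xE; case: Av.
by move/rowP/(_ j): vE; rewrite mxE => ->; case: Av.
Qed.

End lebesgue_rV.

Section darts.
Context d (T : measurableType d) (R : realType) (P : probability T R) (n : nat).
Implicit Types (X : {RV P >-> 'rV[R]_n}) (f : 'rV[R]_n -> R).

(* Integrals of functions bounded from above may be -oo, so that the
   expectation and its supremum are extended reals. *)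
Definition dart_sup X f (r : R) : \bar R :=
  ereal_sup [set 'E_P[fun w => f (a + r *: X w)%R]%E | a in [set: 'rV[R]_n]].

Definition reasonable X f : Prop :=
  {in `]0, +oo[ &, nonincreasing_fun (dart_sup X f)}.

End darts.

Definition payoff (R : realType) n (f : 'rV[R]_n -> R) : Prop :=
  measurable_fun setT f /\ has_ubound (range f).

Definition compactly_supported (R : realType) n (f : 'rV[R]_n -> R) : Prop :=
  compact (closure [set x | f x != 0]).

(* Main.v *)
Require Import Defs.
From HB Require Import structures.
From mathcomp Require Import all_boot all_order all_algebra.
From mathcomp Require Import all_classical all_reals all_analysis measurable_realfun.

(** If the pair (X, f) is not reasonable there are 0 < r <= s with
    g(r) < g(s), hence a point b with g(r) < E f(b + s X). After adding a
    constant to f we may assume f >= 0, and we are left with a constant C such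
    that E f(a + r X) <= C for all a, while C < E f(b + s X); such an f is
    called separating. It remains to improve the regularity of f without
    losing separation.

    Compact support is obtained by truncating f to large boxes: this only
    decreases E f(a + r X), and E f(b + s X) is recovered in the limit by
    dominated convergence ([truncation_separating]).

    Continuity is obtained by averaging, one coordinate at a time. Replace f by
    its mean over the segment from x to x + e s e_i, where e_i is the i-th
    basis vector. The bound for the scale r survives because the new
    expectation is an average of the numbers E f(a' + r X) <= C
    ([line_avg_expectation_le]). The mean is Lipschitz in the direction e_i
    ([uniform_line_avg_lipschitz]), and it stays Lipschitz in every direction in
    which f was ([line_avg_lipschitz]); after all coordinates have been
    treated the function is therefore continuous
    ([coord_lipschitz_continuous]).

    Absolute continuity of the law of X is what keeps the strict inequality at
    scale s. On each line parallel to e_i the one-dimensional Lebesgue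
    differentiation theorem says that the means converge almost everywhere to
    f as e tends to 0. The set of points where convergence fails thus meets
    every such line in a null set, so it is Lebesgue-null by Fubini
    ([lebesgue_rV_null_slices]), so X avoids it almost surely, and dominated
    convergence gives convergence of the expectations
    ([uniform_line_avg_expectation_cvg]). Averaging along lines rather than
    over boxes reduces all the measure theory to dimension one. *)

Import Order.TTheory GRing.Theory Num.Theory.
Import numFieldNormedType.Exports.

Local Open Scope classical_set_scope.
Local Open Scope ring_scope.

Set Implicit Arguments.
Unset Strict Implicit.
Unset Printing Implicit Defensive.

(** * Measurability of vector-valued maps *)

Section measurability.
Context {d} {T : measurableType d} {R : realType} {n : nat}.

Lemma measurable_rVD (F G : T -> 'rV[R]_n) :
  measurable_fun setT F -> measurable_fun setT G ->
  measurable_fun setT (fun t => F t + G t).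
Proof.
move=> mF mG; apply: measurable_fun_rV => i; under eq_fun do rewrite mxE.
by apply: measurable_funD;
  [exact: (measurableT_comp (measurable_coord_rV i) mF)
  |exact: (measurableT_comp (measurable_coord_rV i) mG)].
Qed.

Lemma measurable_rVZ (c : T -> R) (F : T -> 'rV[R]_n) :
  measurable_fun setT c -> measurable_fun setT F ->
  measurable_fun setT (fun t => c t *: F t).
Proof.
move=> mc mF; apply: measurable_fun_rV => i; under eq_fun do rewrite mxE.
apply: measurable_funM => //.
exact: (measurableT_comp (measurable_coord_rV i) mF).
Qed.

Lemma measurable_rV_affine (a : 'rV[R]_n) (r : R) (F : T -> 'rV[R]_n) :
  measurable_fun setT F -> measurable_fun setT (fun t => a + r *: F t).
Proof.
by move=> mF; apply: measurable_rVD => //; exact: measurable_rVZ.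
Qed.

End measurability.

(** * Averages along a line *)

Section line_average.
Context {R : realType} {n : nat}.
Implicit Types (U : probability (measurableTypeR R) R) (v w x : 'rV[R]_n).
Implicit Types (f : 'rV[R]_n -> R) (M : R).

Definition line_avg U v f x : R :=
  fine (\int[U]_u (f (x + (u : R) *: v))%:E).

Lemma measurable_line f v x : measurable_fun setT f ->
  measurable_fun [set: measurableTypeR R] (fun u => f (x + (u : R) *: v)).
Proof.
move=> mf; apply: (measurableT_comp mf).
by apply: measurable_rVD => //; exact: measurable_rVZ.
Qed.

(** One inequality suffices: exchanging x and x + t w gives the other one. *)
Definition lipschitz_along (L : R) w (g : 'rV[R]_n -> R) :=
  forall x (t : R), g (x + t *: w) <= g x + L * `|t|.

Section bounded.
Context (f : 'rV[R]_n -> R) (M : R).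
Hypotheses (mf : measurable_fun setT f) (f0 : forall x, 0 <= f x)
  (fM : forall x, f x <= M).

Lemma integral_line_le U v x : (\int[U]_u (f (x + (u : R) *: v))%:E <= M%:E)%E.
Proof.
apply: (@le_trans _ _ (\int[U]_u (M%:E))%E).
  apply: ge0_le_integral => //.
  - by move=> u _; rewrite lee_fin.
  - by apply/measurable_EFinP; exact: measurable_line.
  - by move=> u _; rewrite lee_fin.
by rewrite integral_cst//= probability_setT mule1.
Qed.

Lemma line_avgE U v x :
  (line_avg U v f x)%:E = (\int[U]_u (f (x + (u : R) *: v))%:E)%E.
Proof.
rewrite fineK// ge0_fin_numE; first exact: le_lt_trans (integral_line_le _ _ _) (ltry _).
by apply: integral_ge0 => u _; rewrite lee_fin.
Qed.

Lemma line_avg_ge0 U v x : 0 <= line_avg U v f x.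
Proof. by rewrite fine_ge0// integral_ge0// => u _; rewrite lee_fin. Qed.

Lemma line_avg_le U v x : line_avg U v f x <= M.
Proof. by rewrite -lee_fin line_avgE integral_line_le. Qed.

Lemma measurable_line_avg U v : measurable_fun setT (line_avg U v f).
Proof.
apply: (measurableT_comp (fine_measurable measurableT)).
apply: (@measurable_fun_fubini_tonelli_F _ _ _ _ _ U
  (fun p : 'rV[R]_n * measurableTypeR R => (f (p.1 + (p.2 : R) *: v))%:E)).
  apply/measurable_EFinP/(measurableT_comp mf).
  by apply: measurable_rVD; [exact: measurable_fst|exact: measurable_rVZ].
by move=> p; rewrite lee_fin.
Qed.

(** By Tonelli the left-hand side is the U-average over u of the expectations of
    f((a + u v) + Y), each of which is an instance of the hypothesis. *)
Lemma line_avg_expectation_le d (T : measurableType d) (P : probability T R)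
    (Y : T -> 'rV[R]_n) (C : \bar R) U v :
  measurable_fun setT Y ->
  (forall a, \int[P]_t (f (a + Y t))%:E <= C)%E ->
  forall a, (\int[P]_t (line_avg U v f (a + Y t))%:E <= C)%E.
Proof.
move=> mY YC a; under eq_integral do rewrite line_avgE.
pose F (p : T * measurableTypeR R) := (f (a + Y p.1 + (p.2 : R) *: v))%:E.
have mF : measurable_fun setT F.
  apply/measurable_EFinP/(measurableT_comp mf)/measurable_rVD.
    apply: measurable_rVD => //; apply: (measurableT_comp mY); exact: measurable_fst.
  by apply: measurable_rVZ => //; exact: measurable_snd.
have F0 p : (0 <= F p)%E by rewrite lee_fin.
have := @fubini_tonelli _ _ _ _ _ P U F mF F0; rewrite /fubini_F/= => ->.
have C0 : (0 <= C)%E.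
  by apply: le_trans (YC 0); apply: integral_ge0 => t _; rewrite lee_fin.
apply: (@le_trans _ _ (\int[U]_u C)%E); last first.
  by rewrite integral_cst//= probability_setT mule1.
apply: ge0_le_integral => //.
- by move=> u _; exact: integral_ge0.
- exact: (measurable_fun_fubini_tonelli_G (m1 := P)).
- move=> u _; rewrite /fubini_G /F/=.
  by under eq_integral do rewrite addrAC; exact: YC.
Qed.

(** Averaging integrates translates of f, and translates of f share its Lipschitz
    constants. *)
Lemma line_avg_lipschitz U v w L :
  lipschitz_along L w f -> lipschitz_along L w (line_avg U v f).
Proof.
move=> lf x t; rewrite -lee_fin EFinD !line_avgE.
(* Going forth and back along w shows that L |t| is nonnegative. *)
have L0 : 0 <= L * `|t|.
  have := lf x t; have := lf (x + t *: w) (- t); rewrite scaleNr addrK normrN.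
  move=> h1 h2; have := le_trans h1 (lerD h2 (lexx _)).
  by rewrite -addrA lerDl -mulr2n pmulrn_lge0.
have <- : (\int[U]_u (L * `|t|)%:E)%E = (L * `|t|)%:E.
  by rewrite integral_cst//= probability_setT mule1.
rewrite -ge0_integralD//; last 2 first.
- by move=> u _; rewrite lee_fin.
- by apply/measurable_EFinP; exact: measurable_line.
apply: ge0_le_integral => //.
- by move=> u _; rewrite lee_fin.
- by apply/measurable_EFinP; exact: measurable_line.
- by apply: emeasurable_funD => //; apply/measurable_EFinP; exact: measurable_line.
- by move=> u _; rewrite -EFinD lee_fin addrAC.
Qed.

End bounded.
End line_average.

(** * One-dimensional Lebesgue measure: translations and shrinking windows *)

Section translation.
Context {R : realType}.
Local Notation mu := (@lebesgue_measure R).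

Lemma lebesgue_measure_translate (t : R) (A : set R) : measurable A ->
  pushforward mu (+%R t : measurableTypeR R -> measurableTypeR R) A = mu A.
Proof.
have mt : measurable_fun setT (+%R t : measurableTypeR R -> measurableTypeR R).
  by apply: measurable_funD => //; exact: measurable_id.
move=> mA; apply/esym.
apply: (@lebesgue_measure_unique R
  (pushforward mu (+%R t : measurableTypeR R -> measurableTypeR R))) => //.
move=> _ [[a b]] _ <-.
change (mu `]a, b]%classic = mu ((+%R t : R -> R) @^-1` `]a, b]%classic)).
rewrite (_ : _ @^-1` _ = `]a - t, b - t]%classic).
  by rewrite !lebesgue_measure_itv/= !lte_fin ltrD2r -!EFinB opprB addrA subrK.
by apply/seteqP; split=> u /=; rewrite !in_itv/= ltrBlDl lerBrDl.
Qed.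

Lemma ge0_integral_translate (t a b : R) (g : R -> \bar R) :
  measurable_fun setT g -> (forall u, 0 <= g u)%E ->
  (\int[mu]_(u in `[a, b]) g (t + u)%R =
   \int[mu]_(u in `[(t + a)%R, (t + b)%R]) g u)%E.
Proof.
move=> mg g0.
have mt : measurable_fun setT (+%R t : measurableTypeR R -> measurableTypeR R).
  by apply: measurable_funD => //; exact: measurable_id.
rewrite (_ : `[a, b]%classic = (+%R t : measurableTypeR R -> measurableTypeR R)
    @^-1` `[t + a, t + b]%classic); last first.
  by apply/seteqP; split=> u /=; rewrite !in_itv/= !lerD2l.
rewrite -(@ge0_integral_pushforward _ _ _ _ _ _ mt mu `[t + a, t + b]%classic g)//.
  by apply: eq_measure_integral => //= A mA _; exact: lebesgue_measure_translate.
exact: measurable_funS mg.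
Qed.

(** The window [t, t + e] exceeds [0, e] by an interval of length at most |t|,
    on which g is at most M. *)
Lemma integral_window_le (M t e : R) (g : R -> R) : 0 <= e ->
  measurable_fun setT g -> (forall u, 0 <= g u <= M) ->
  (\int[mu]_(u in `[t, (t + e)%R]) (g u)%:E <=
   \int[mu]_(u in `[0%R, e]) (g u)%:E + (M * `|t|)%:E)%E.
Proof.
move=> e0 mg gM.
have M0 : 0 <= M by have /andP[g0 /(le_trans g0)] := gM 0.
(* K is the part of the window that may lie outside [0, e]: it is on the right
   of [0, e] for t >= 0 and on its left for t < 0. *)
suff H (K : set R) : measurable K -> (mu K <= `|t|%:E)%E ->
    [disjoint `[0, e]%classic & K] ->
    `[t, t + e]%classic `<=` `[0, e]%classic `|` K ->
    (\int[mu]_(u in `[t, (t + e)%R]) (g u)%:E <=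
     \int[mu]_(u in `[0%R, e]) (g u)%:E + (M * `|t|)%:E)%E.
  have [t0|t0] := leP 0 t.
    apply: (H `]e, e + t]%classic) => //.
    - rewrite lebesgue_measure_itv/= lte_fin ltrDl -EFinB addrAC subrr add0r ger0_norm//.
      by case: ifPn.
    - apply/disj_setPS => u [/=]; rewrite !in_itv/= => /andP[_ ue] /andP[eu _].
      by move: eu; rewrite ltNge ue.
    - move=> u /=; rewrite !in_itv/= => /andP[tu ut].
      have [ue|eu] := leP u e; [left|right]; last by rewrite addrC.
      by rewrite (le_trans t0).
  apply: (H `[t, 0[%classic) => //.
  - by rewrite lebesgue_measure_itv/= lte_fin t0 -EFinB sub0r ltr0_norm.
  - apply/disj_setPS => u [/=]; rewrite !in_itv/= => /andP[u0 _] /andP[_].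
    by rewrite ltNge u0.
  - move=> u /=; rewrite !in_itv/= => /andP[tu ut].
    have [u0|u0] := leP 0 u; [left|right]; last by rewrite tu.
    by rewrite (le_trans ut)// gerDr ltW.
move=> mK muK dK sub.
have mgK (A : set R) : measurable A -> measurable_fun A (EFin \o g).
  by move=> mA; apply/measurable_EFinP; exact: measurable_funS mg.
have g0 (u : R) : (0 <= (g u)%:E)%E by rewrite lee_fin; case/andP: (gM u).
apply: (@le_trans _ _ (\int[mu]_(u in `[0%R, e]%classic `|` K) (g u)%:E)%E).
  apply: ge0_subset_integral => //; first exact: measurableU.
  by apply: mgK; exact: measurableU.
rewrite ge0_integral_setU//; last by apply: mgK; exact: measurableU.
rewrite leeD2l//.
apply: (@le_trans _ _ (\int[mu]_(u in K) M%:E)%E).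
  apply: ge0_le_integral => //; first exact: mgK.
  by move=> u _; rewrite lee_fin; case/andP: (gM u).
by rewrite integral_cst// EFinM lee_wpmul2l.
Qed.

End translation.

Section shrinking_window.
Context {R : realType}.
Local Notation mu := (@lebesgue_measure R).

Lemma invSn_gt0 (k : nat) : 0 < k.+1%:R^-1 :> R.
Proof. by rewrite invr_gt0 ltr0n. Qed.

(** The window of length 1/(k+1) starting at x sits in the ball of radius
    2/(k+1), whose measure 4/(k+1) is 4 times larger. *)
Lemma nicely_shrinking_window (x : R) :
  nicely_shrinking x (fun k => `[x, x + k.+1%:R^-1]%classic).
Proof.
split=> //; exists (4, fun k => PosNum (mulr_gt0 (ltr0n R 2) (invSn_gt0 k))); split.
- by rewrite /= ltr0n.
- rewrite /= -[X in _ --> X](mulr0 2); apply: cvgM; first exact: cvg_cst.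
  exact: cvg_harmonic.
- move=> k u; rewrite /= in_itv/= /ball/= => /andP[xu ux].
  rewrite ler0_norm ?subr_le0// opprB ltrBlDl (le_lt_trans ux)// ltrD2l.
  by rewrite ltr_pMl ?invSn_gt0// ltr1n.
- move=> k; rewrite lebesgue_measure_ball ?mulr_ge0//=.
  rewrite lebesgue_measure_itv/= lte_fin ltrDl invSn_gt0 -EFinD addrAC subrr add0r.
  by rewrite -EFinM lee_fin -[leLHS]mulr_natl mulrA -natrM.
Qed.

(** Lebesgue differentiation, with one-sided windows in place of balls. *)
Lemma window_avg_cvg (g : R -> R) (M : R) : measurable_fun setT g ->
  (forall u, 0 <= g u <= M) ->
  {ae mu, forall t, (k.+1%:R%:E * \int[mu]_(u in `[t, (t + k.+1%:R^-1)%R]) (g u)%:E)%E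
    @[k --> \oo] --> (g t)%:E}.
Proof.
move=> mg gM.
have lg : locally_integrable setT g.
  split=> [//||K _ cK]; first exact: openT.
  have mK : measurable K by exact: compact_measurable.
  apply: (@le_lt_trans _ _ (\int[mu]_(u in K) M%:E)%E).
    apply: ge0_le_integral => //.
    - apply/measurable_EFinP; apply: measurableT_comp => //; exact: measurable_funS mg.
    - by move=> u _; rewrite lee_fin; have /andP[g0 ?] := gM u; rewrite ger0_norm.
  rewrite integral_cst// lte_mul_pinfty// ?lee_fin; last first.
    exact: compact_finite_measure.
  by have /andP[g0 /(le_trans g0)] := gM 0.
have := lebesgue_differentiation lg.
apply: filterS; first exact: (ae_filter_ringOfSetsType mu).
move=> t gt.
have := nice_lebesgue_differentiation nicely_shrinking_window lg gt.
apply: cvg_trans; apply: near_eq_cvg; apply: nearW => k /=.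
rewrite lebesgue_measure_itv/= lte_fin ltrDl invSn_gt0 -EFinD addrAC subrr add0r.
by rewrite inver gt_eqF ?invSn_gt0// invrK.
Qed.

End shrinking_window.

(** * Uniform averages along a segment *)

Section uniform_line_average.
Context {R : realType} {n : nat}.
Context (f : 'rV[R]_n -> R) (M : R).
Hypotheses (mf : measurable_fun setT f) (f0 : forall x, 0 <= f x)
  (fM : forall x, f x <= M).
Local Notation mu := (@lebesgue_measure R).

(** Written as an integral of the fixed function u |-> f(x + u v) over the moving
    window [t, t + e], the average becomes accessible to the one-dimensional
    lemmas above. *)
Lemma uniform_line_avgE (e : R) (e0 : 0 < e) (v x : 'rV[R]_n) (t : R) :
  (line_avg (uniform_prob e0) v f (x + t *: v))%:E =
  (e^-1%:E * \int[mu]_(u in `[t, (t + e)%R]) (f (x + u *: v))%:E)%E.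
Proof.
rewrite (line_avgE mf f0 fM) integral_uniform ?subr0; last 2 first.
- by apply/measurable_EFinP; exact: measurable_line.
- by move=> u; rewrite lee_fin.
congr (_ * _)%E.
under eq_integral do rewrite -addrA -scalerDl.
rewrite (@ge0_integral_translate R t 0 e (fun u => (f (x + u *: v))%:E)) ?addr0//.
- by apply/measurable_EFinP; exact: measurable_line.
- by move=> u; rewrite lee_fin.
Qed.

Lemma uniform_line_avg_lipschitz (e : R) (e0 : 0 < e) (v : 'rV[R]_n) :
  lipschitz_along (e^-1 * M) v (line_avg (uniform_prob e0) v f).
Proof.
move=> x t; rewrite -lee_fin EFinD.
rewrite -[in leRHS](addr0 x) -(scale0r v) !uniform_line_avgE add0r.
rewrite -mulrA EFinM -muleDr//; last first.
  by apply: ge0_adde_def; rewrite inE; [apply: integral_ge0 => u _; rewrite lee_fin|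
    rewrite lee_fin mulr_ge0// (le_trans (f0 0) (fM 0))].
apply: lee_pmul => //; first by rewrite lee_fin invr_ge0 ltW.
  by apply: integral_ge0 => u _; rewrite lee_fin.
apply: (@integral_window_le _ M t e (fun u => f (x + u *: v))).
- exact: ltW.
- exact: measurable_line.
- by move=> u; rewrite f0 fM.
Qed.

Lemma uniform_line_avg_eq0 (e : R) (e0 : 0 < e) (v x : 'rV[R]_n) :
  (forall u, 0 <= u <= e -> f (x + u *: v) = 0) ->
  line_avg (uniform_prob e0) v f x = 0.
Proof.
move=> fx0; apply: EFin_inj.
rewrite -[in LHS](addr0 x) -(scale0r v) uniform_line_avgE.
rewrite (eq_integral (cst 0%E)) ?integral0 ?mule0// => u.
by rewrite inE/= in_itv/= add0r => /fx0 ->.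
Qed.

(** The step lengths run through the sequence 1/(k+1), so that measurability
    and dominated convergence only ever involve countably many functions. *)
Lemma uniform_line_avg_cvg (v x : 'rV[R]_n) :
  {ae mu, forall t : R,
    line_avg (uniform_prob (invSn_gt0 k)) v f (x + t *: v) @[k --> \oo]
    --> f (x + t *: v)}.
Proof.
have gM u : 0 <= f (x + u *: v) <= M by rewrite f0 fM.
have := window_avg_cvg (measurable_line v x mf) gM.
apply: filterS; first exact: (ae_filter_ringOfSetsType mu).
move=> t /fine_cvg; set F := fine \o _.
have -> : F = fun k => line_avg (uniform_prob (invSn_gt0 k)) v f (x + t *: v).
  apply/funext => k; rewrite -[RHS]/(fine (line_avg _ _ _ _)%:E).
  by rewrite uniform_line_avgE invrK.
exact.
Qed.

End uniform_line_average.

(** * Sets with null slices in one direction *)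

Section null_slices.
Context {R : realType}.
Local Notation mu := (@lebesgue_measure R).

Lemma cons_rV_head n (p : measurableTypeR R * 'rV[R]_n) :
  cons_rV p ord0 ord0 = p.1.
Proof. by rewrite -[in RHS](cons_rVK p). Qed.

Lemma cons_rV_tail n (p : measurableTypeR R * 'rV[R]_n) i :
  cons_rV p ord0 (lift ord0 i) = p.2 ord0 i.
Proof. by rewrite -[in RHS](cons_rVK p)/= mxE. Qed.

Lemma coord_shift n (v : 'rV[R]_n) (t : R) (i k : 'I_n) :
  (v + t *: delta_mx ord0 i) ord0 k = v ord0 k + t * (k == i)%:R.
Proof. by rewrite !mxE eqxx. Qed.

Lemma cons_rVDl n (t : R) (v : 'rV[R]_n) :
  cons_rV (t, v) = cons_rV (0, v) + t *: delta_mx ord0 ord0.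
Proof.
apply/rowP => k; rewrite coord_shift; have [j ->|->] := unliftP ord0 k.
  by rewrite !cons_rV_tail/= mulr0 addr0.
by rewrite !cons_rV_head eqxx/= mulr1 add0r.
Qed.

Lemma cons_rVDr n (x t : R) (v : 'rV[R]_n) (j : 'I_n) :
  cons_rV (x, v + t *: delta_mx ord0 j) =
  cons_rV (x, v) + t *: delta_mx ord0 (lift ord0 j).
Proof.
apply/rowP => k; rewrite coord_shift; have [l ->|->] := unliftP ord0 k.
  by rewrite !cons_rV_tail/= coord_shift (inj_eq lift_inj).
by rewrite !cons_rV_head/= mulr0 addr0.
Qed.

(** Induction on the dimension, peeling off the coordinate 0. If i is a later
    coordinate, the slices at a fixed value of coordinate 0 are null by
    induction. If i is coordinate 0 itself, the product measure has to be
    integrated in the other order, which is where uniqueness of the product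
    measure comes in. *)
Lemma lebesgue_rV_null_slices n (i : 'I_n) (N : set 'rV[R]_n) :
  measurable N ->
  (forall x, mu [set t : R | N (x + t *: delta_mx ord0 i)] = 0%E) ->
  lebesgue_rV R n N = 0%E.
Proof.
elim: n i N => [[]//|n IH] i N mN N0.
have mN' : measurable (@cons_rV R n @^-1` N).
  by rewrite -[X in measurable X]setTI; exact: measurable_cons_rV.
change ((mu \x lebesgue_rV R n) (@cons_rV R n @^-1` N) = 0)%E.
have [j ij|i0] := unliftP ord0 i.
  rewrite /product_measure1; apply: integral0_eq => t _ /=.
  apply: (IH j); first exact: measurable_xsection.
  move=> v; rewrite -(N0 (cons_rV (t, v))); congr mu; apply/seteqP.
  by split=> u /=; rewrite /xsection/= inE/= cons_rVDr -ij.
rewrite (@product_measure_unique _ _ _ _ R mu (lebesgue_rV R n)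
  (mu \x^ lebesgue_rV R n)%E)//; last exact: product_measure2E.
change ((\int[lebesgue_rV R n]_v mu (ysection (@cons_rV R n @^-1` N) v))%E = 0%E).
apply: integral0_eq => v _ /=.
rewrite -(N0 (cons_rV (0, v))); congr mu; apply/seteqP.
by split=> u; rewrite /ysection/= inE /preimage/= (cons_rVDl u) i0.
Qed.

End null_slices.

(** * Almost sure convergence of the averages *)

Section almost_sure_convergence.
Context {R : realType}.

(** Convergence to h means that the superior limit of |h_k - h| is 0, and this
    superior limit is a measurable function. *)
Lemma measurable_cvg_set d (S : measurableType d) (h_ : (S -> R)^nat) (h : S -> R) :
  (forall k, measurable_fun setT (h_ k)) -> measurable_fun setT h ->
  measurable [set x | h_ k x @[k --> \oo] --> h x].
Proof.
move=> mh_ mh; pose D k x := (`|h_ k x - h x|)%:E.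
have mD k : measurable_fun setT (D k).
  apply/measurable_EFinP; apply: measurableT_comp => //.
  exact: measurable_funB.
rewrite (_ : [set _ | _] = (fun x => limn_esup (D ^~ x)) @^-1` [set 0%E]).
  rewrite -[X in measurable X]setTI.
  by apply: (measurable_fun_limn_esup mD) => //; exact: emeasurable_set1.
apply/seteqP; split => x /=.
  move=> hx; have Dx : D ^~ x @ \oo --> 0%E.
    apply: cvg_EFin; first exact: nearW.
    rewrite (_ : fine \o _ = fun k => `|h_ k x - h x|)//.
    exact/norm_cvg0P/subr_cvg0.
  rewrite is_cvg_limn_esupE; first exact/cvg_lim.
  by apply/cvg_ex; exists 0%E.
move=> Dx0; have : D ^~ x @ \oo --> 0%E.
  by apply: limn_esup_le_cvg; [rewrite Dx0|move=> k; rewrite lee_fin].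
by move/fine_cvg => /norm_cvg0P/subr_cvg0.
Qed.

Section expectation.
Context {d} {T : measurableType d} (P : probability T R) {n : nat}.
Context (X : {RV P >-> 'rV[R]_n}).
Hypothesis Xac : distribution P X `<< lebesgue_rV R n.

(** The direction s e_i is scaled by s so that moving x by t e_i moves the
    point b + s x by t times the averaging direction: the exceptional set,
    pulled back to the space where X lives, is then directly described by
    [uniform_line_avg_cvg] on each line. *)
Lemma uniform_line_avg_expectation_cvg (f : 'rV[R]_n -> R) (M : R)
    (b : 'rV[R]_n) (s : R) (i : 'I_n) :
  measurable_fun setT f -> (forall x, 0 <= f x) -> (forall x, f x <= M) ->
  (\int[P]_w (line_avg (uniform_prob (invSn_gt0 k)) (s *: delta_mx ord0 i)
     f (b + s *: X w))%:E @[k --> \oo] -->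
   \int[P]_w (f (b + s *: X w))%:E)%E.
Proof.
move=> mf f0 fM.
pose v : 'rV[R]_n := s *: delta_mx ord0 i.
pose h_ k x := line_avg (uniform_prob (invSn_gt0 k)) v f (b + s *: x).
pose h x := f (b + s *: x).
have mb : measurable_fun setT (fun x : 'rV[R]_n => b + s *: x).
  by apply: measurable_rV_affine; exact: measurable_id.
have mh_ k : measurable_fun setT (h_ k).
  exact: (measurableT_comp (measurable_line_avg mf f0 _ _) mb).
have mh : measurable_fun setT h by exact: (measurableT_comp mf mb).
have mX : measurable_fun setT X by [].
(* N is the exceptional set, in the coordinates of X. *)
pose N := ~` [set x | h_ k x @[k --> \oo] --> h x].
have mN : measurable N by apply: measurableC; exact: measurable_cvg_set.
have N0 : lebesgue_rV R n N = 0%E.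
  apply: (lebesgue_rV_null_slices (i := i)) => // x.
  apply/negligibleP.
    rewrite -[X in measurable X]setTI.
    exact: (measurable_rVD (measurable_cst x)
      (measurable_rVZ (measurable_id (D := setT)) (measurable_cst (delta_mx ord0 i)))).
  have := uniform_line_avg_cvg mf f0 fM v (b + s *: x).
  rewrite /almost_everywhere; congr (_.-negligible _).
  apply/seteqP; split=> t; rewrite /N /h_ /h /=.
    by rewrite scalerDr !scalerA addrA (mulrC s) -scalerA.
  by rewrite scalerDr !scalerA addrA (mulrC s) -scalerA.
have PN : P (X @^-1` N) = 0%E by move/null_content_dominatesP : Xac; exact.
have [] := @dominated_convergence _ T R P setT measurableT
  (fun k w => (h_ k (X w))%:E) (fun w => (h (X w))%:E) (cst M%:E).
- by move=> k; apply/measurable_EFinP; exact: (measurableT_comp (mh_ k)).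
- by apply/measurable_EFinP; exact: (measurableT_comp mh).
- exists (X @^-1` N); split => //.
    by rewrite -[X in measurable X]setTI; exact: mX.
  move=> w /= /not_implyP[_] hw /= hXw; apply: hw.
  by apply: cvg_EFin; [exact: nearW|exact: hXw].
- exact: finite_measure_integrable_cst.
- apply: aeW => w k _ /=; rewrite lee_fin ger0_norm; first exact: (line_avg_le mf f0 fM).
  exact: line_avg_ge0.
- by [].
Qed.

End expectation.
End almost_sure_convergence.

(** * Regularity and support of functions on row vectors *)

Section coordinatewise_lipschitz.
Context {R : realType} {n : nat}.
Implicit Types (f : 'rV[R]_n -> R) (i : 'I_n).

Definition coord_lipschitz f i :=
  exists L, lipschitz_along L (delta_mx ord0 i) f.

Lemma lipschitz_along_scale (L s : R) (w : 'rV[R]_n) f : s != 0 ->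
  lipschitz_along L (s *: w) f -> lipschitz_along (L / `|s|) w f.
Proof.
move=> s0 fL x t; have := fL x (t / s).
by rewrite scalerA divfK// normrM normfV mulrCA mulrC.
Qed.

(** One can go from x to y along the coordinate directions, one after the other,
    so that f(y) - f(x) is at most the sum of the L_i |y_i - x_i|. *)
Lemma coord_lipschitz_continuous f : (forall i, coord_lipschitz f i) ->
  continuous f.
Proof.
move=> /choice[L fL].
have L0 i : 0 <= L i.
  have := fL i 0 1; have := fL i (0 + 1 *: delta_mx ord0 i) (- 1).
  rewrite scaleNr addrK normrN normr1 mulr1 => h1 h2.
  have := le_trans h1 (lerD h2 (lexx _)).
  by rewrite -addrA lerDl -mulr2n pmulrn_lge0.
have step (x : 'rV[R]_n) (c : 'I_n -> R) (l : seq 'I_n) :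
    f (x + \sum_(i <- l) c i *: delta_mx ord0 i) <= f x + \sum_(i <- l) L i * `|c i|.
  elim: l x => [|i l IH] x; first by rewrite !big_nil !addr0.
  rewrite !big_cons !addrA (le_trans (IH _))// lerD2r; exact: fL.
have lip (x y : 'rV[R]_n) : f y <= f x + \sum_i L i * `|y ord0 i - x ord0 i|.
  have := step x (fun i => y ord0 i - x ord0 i) (index_enum 'I_n).
  have -> : \sum_i (y ord0 i - x ord0 i) *: delta_mx ord0 i = y - x.
    by rewrite [RHS]row_sum_delta; apply: eq_bigr => i _; rewrite !mxE.
  by rewrite subrKC.
move=> x; apply: (@cvgrPdist_lt _ R^o _ (nbhs x) _ f (f x)).2 => e e0.
pose S := \sum_i L i + 1.
have S0 : 0 < S by rewrite ltr_wpDl// sumr_ge0.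
apply/nbhs_ballP; exists (e / S) => /=; first exact: divr_gt0.
move=> y [_ xy].
have bound : \sum_i L i * `|y ord0 i - x ord0 i| < e.
  apply: (@le_lt_trans _ _ ((\sum_i L i) * (e / S))).
    rewrite mulr_suml ler_sum// => i _; rewrite ler_wpM2l//.
    by rewrite distrC ltW//; exact: (xy ord0 i).
  rewrite mulrCA gtr_pMr// ltr_pdivrMr// mul1r ltrDl//.
rewrite ltr_distlC; apply/andP; split.
  rewrite ltrBlDr (le_lt_trans (lip y x))// ltrD2l (le_lt_trans _ bound)//.
  by apply: ler_sum => i _; rewrite distrC.
by rewrite (le_lt_trans (lip x y))// ltrD2l.
Qed.

End coordinatewise_lipschitz.

Section bounded_support.
Context {R : realType} {n : nat}.

Definition box (K : R) : set 'rV[R]_n := [set v | forall i, `|v ord0 i| <= K].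

Lemma boxE K : box K = [set v | forall i, `[- K, K]%classic (v ord0 i)].
Proof. by apply/seteqP; split=> v vK i; have := vK i; rewrite /= in_itv/= ler_norml. Qed.

Lemma box_compact K : compact (box K).
Proof.
rewrite boxE; apply: (@rV_compact R n (fun=> `[- K, K]%classic)) => i.
exact: segment_compact.
Qed.

Lemma box_closed K : closed (box K).
Proof.
rewrite boxE [X in closed X](_ : _ = \bigcap_i
   ((fun v : 'rV[R]_n => v ord0 i) @^-1` `[- K, K]%classic)).
  apply: closed_bigI => i _; apply: closed_comp; last exact: interval_closed.
  by move=> v _; exact: (@coord_continuous _ 1 n ord0 i v).
by apply/seteqP; split=> v vK => [i _|i]; exact: vK.
Qed.

Lemma box_measurable K : measurable (box K).
Proof.
rewrite -(setCK (box K)); apply: measurableC; apply: measurable_rV_open.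
rewrite openC; exact: box_closed.
Qed.

Lemma box_compactly_supported K (f : 'rV[R]_n -> R) :
  (forall x, f x != 0 -> box K x) -> compactly_supported f.
Proof.
move=> fK; apply: (@subclosed_compact _ _ (box K)).
- exact: closed_closure.
- exact: box_compact.
- have /closure_id -> := box_closed (K := K).
  exact: closureS.
Qed.

End bounded_support.

(** * Separating the two scales *)

Lemma cvg_exists_gt {R : realType} (u : (\bar R)^nat) (l C : \bar R) :
  u @ \oo --> l -> (C < l)%E -> exists k, (C < u k)%E.
Proof.
move=> ul Cl; apply: contrapT => /forallNP uC; move: Cl; apply/negP; rewrite -leNgt.
rewrite -(cvg_lim _ ul)//; apply: lime_le; first by apply/cvg_ex; exists l.
by apply: nearW => k; rewrite leNgt; apply/negP.
Qed.

Section separation.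
Context {d} {T : measurableType d} {R : realType} (P : probability T R) {n : nat}.
Context (X : {RV P >-> 'rV[R]_n}).
Hypothesis Xac : distribution P X `<< lebesgue_rV R n.
Context (r s : R) (C : \bar R) (b : 'rV[R]_n).
Hypothesis s0 : s != 0.

(** A throw at scale s aimed at b beats C, a bound for all throws at
    scale r. The constant C and the point b stay the same throughout the
    regularization of f. *)
Definition separating (f : 'rV[R]_n -> R) : Prop :=
  (forall a, \int[P]_w (f (a + r *: X w))%:E <= C)%E /\
  (C < \int[P]_w (f (b + s *: X w))%:E)%E.

Definition bounded_box_payoff (f : 'rV[R]_n -> R) : Prop :=
  [/\ measurable_fun setT f, forall x, 0 <= f x, exists M, forall x, f x <= M
    & exists K, forall x, f x != 0 -> box K x].

Let mX : measurable_fun setT X. Proof. by []. Qed.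

(** As f >= 0, truncation lowers the expectations at scale r; at scale s they
    increase to that of f when the box grows. *)
Lemma truncation_separating (f : 'rV[R]_n -> R) (M : R) :
  measurable_fun setT f -> (forall x, 0 <= f x) -> (forall x, f x <= M) ->
  separating f -> exists2 g, bounded_box_payoff g & separating g.
Proof.
move=> mf f0 fM [fr fs].
pose g k : 'rV[R]_n -> R := f \_ (box k%:R).
have mg k : measurable_fun setT (g k).
  apply: (measurable_restrictT f (@box_measurable R n k%:R)).1.
  exact: measurable_funS mf.
have g0 k x : 0 <= g k x by rewrite /g patchE; case: ifP.
have gf k x : g k x <= f x by rewrite /g patchE; case: ifP.
have mgX k a t : measurable_fun setT (fun w => (g k (a + t *: X w))%:E).
  apply/measurable_EFinP; apply: (measurableT_comp (mg k)).
  exact: measurable_rV_affine.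
have mfX a t : measurable_fun setT (fun w => (f (a + t *: X w))%:E).
  apply/measurable_EFinP; apply: (measurableT_comp mf).
  exact: measurable_rV_affine.
have gcvg x : (g k x)%:E @[k --> \oo] --> (f x)%:E.
  apply: cvg_near_cst; near=> k; congr (_%:E).
  rewrite /g patchE mem_set// => i; apply: (@le_trans _ _ (\sum_i `|x ord0 i|)).
    by rewrite (bigD1 i)//= lerDl sumr_ge0.
  by near: k; exact: nbhs_infty_ger.
have [||||| _ _ cvg] := @dominated_convergence _ T R P setT measurableT
  (fun k w => (g k (b + s *: X w))%:E) (fun w => (f (b + s *: X w))%:E) (cst M%:E).
- by [].
- by [].
- by apply: aeW => w _.
- exact: finite_measure_integrable_cst.
- by apply: aeW => w k _ /=; rewrite lee_fin ger0_norm ?(le_trans (gf _ _))//.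
have [k Ck] : exists k, (C < \int[P]_w (g k (b + s *: X w))%:E)%E.
  exact: cvg_exists_gt cvg fs.
exists (g k); split => //.
- by exists M => x; exact: le_trans (gf _ _) _.
- by exists k%:R => x; rewrite /g patchE; case: ifPn => [/set_mem//|_]; rewrite eqxx.
- by move=> a; apply: le_trans (fr a); apply: ge0_le_integral => // w _; rewrite lee_fin.
Unshelve. all: by end_near. Qed.

(** Averaging over a sufficiently short segment in the direction e_i. *)
Lemma smoothing_step (f : 'rV[R]_n -> R) (i : 'I_n) :
  bounded_box_payoff f -> separating f ->
  exists g, [/\ bounded_box_payoff g, separating g, coord_lipschitz g i
    & forall j, coord_lipschitz f j -> coord_lipschitz g j].
Proof.
move=> [mf f0 [M fM] [K fK]] [fr fs].
pose v : 'rV[R]_n := s *: delta_mx ord0 i.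
pose g k := line_avg (uniform_prob (@invSn_gt0 R k)) v f.
have cvg := @uniform_line_avg_expectation_cvg _ _ _ P n X Xac f M b s i mf f0 fM.
have [k Ck] : exists k, (C < \int[P]_w (g k (b + s *: X w))%:E)%E.
  exact: cvg_exists_gt cvg fs.
exists (g k); split.
- split.
  + exact: measurable_line_avg.
  + exact: line_avg_ge0.
  + by exists M; exact: line_avg_le.
    (* The segments have length at most |s|, as the steps 1/(k+1) are at most 1. *)
  + exists (K + `|s|) => x; apply: contraNP => xK; apply/eqP.
    apply: (uniform_line_avg_eq0 mf f0 fM) => u /andP[u0 u1].
    apply/eqP; apply: contra_notT xK => /fK xK j.
    have := xK j; rewrite /v scalerA coord_shift => xj.
    rewrite -[X in `|X|](addrK (u * s * (j == i)%:R)).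
    rewrite (le_trans (ler_normB _ _))// lerD// !normrM.
    rewrite (ger0_norm u0) mulrAC ler_piMl//.
    rewrite mulr_ile1// ?ler01//; first by rewrite (le_trans u1)// invf_le1// ler1n.
    by case: (j == i); rewrite ?normr1 ?normr0.
- split=> //; apply: (line_avg_expectation_le mf f0 fM) => //.
  exact: measurable_rVZ.
- exists ((k.+1%:R^-1^-1 * M) / `|s|); apply: lipschitz_along_scale => //.
  exact: uniform_line_avg_lipschitz.
- by move=> j [L fL]; exists L; apply: line_avg_lipschitz fL.
Qed.

Lemma separating_smoothing (f : 'rV[R]_n -> R) :
  bounded_box_payoff f -> separating f ->
  exists g, [/\ bounded_box_payoff g, separating g & continuous g].
Proof.
move=> bf sf.
suff [g [bg sg lg]] : exists g, [/\ bounded_box_payoff g, separating g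
    & forall i, i \in enum 'I_n -> coord_lipschitz g i].
  exists g; split=> //; apply: coord_lipschitz_continuous => i.
  by apply: lg; rewrite mem_enum.
elim: (enum 'I_n) => [|i l [g [bg sg lg]]]; first by exists f.
have [h [bh sh hi hl]] := smoothing_step i bg sg.
exists h; split=> // j; rewrite inE => /predU1P[->//|/lg]; exact: hl.
Qed.

End separation.

Lemma integral_addr_cst d (T : measurableType d) (R : realType)
    (P : probability T R) (Y : T -> R) (M : R) :
  measurable_fun setT Y -> (forall w, `|Y w| <= M) ->
  (\int[P]_w (Y w + M)%:E = \int[P]_w (Y w)%:E + M%:E)%E.
Proof.
move=> mY YM; under eq_integral do rewrite EFinD.
rewrite integralD//.
- by rewrite integral_cst//= probability_setT mule1.
- apply: (@le_integrable _ _ _ P setT measurableT _ (cst M%:E)).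
  + exact/measurable_EFinP.
  + by move=> w _ /=; rewrite lee_fin (le_trans (YM w))// ler_norm.
  + exact: finite_measure_integrable_cst.
- exact: finite_measure_integrable_cst.
Qed.

Unset Implicit Arguments.

Theorem theorem1p18 (d : measure_display) (T : measurableType d) (R : realType)
    (P : probability T R) (n : nat) (X : {RV P >-> 'rV[R]_n})
    (f : 'rV[R]_n -> R) :
  distribution P X `<< lebesgue_rV R n ->
  payoff f -> bounded_fun f -> ~ reasonable X f ->
  exists h : 'rV[R]_n -> R,
    [/\ payoff h, forall x, 0 <= h x, continuous h, compactly_supported h
      & ~ reasonable X h].
Proof.
move=> Xac [mf _] bf nf; apply: contrapT => nh; apply: nf => r s r0 s0 rs.
rewrite leNgt; apply/negP => /ereal_sup_gt[_ [b _ <-]].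
rewrite unlock => fs; apply: nh.
have [M _ fM] : exists2 M, 0 < M & forall x, `|f x| <= M.
  by have [M M0 fM] := pinfty_ex_gt0 bf; exists M => // x; exact: fM.
have mX : measurable_fun setT X by [].
have mfX a t : measurable_fun setT (fun w => f (a + t *: X w)).
  by apply: (measurableT_comp mf); exact: measurable_rV_affine.
have s_gt0 : 0 < s by move: s0; rewrite in_itv/= andbT.
(* Adding M makes f nonnegative and shifts every expectation by M. *)
have [||||g bg sg] := @truncation_separating _ T R P n X r s
  (dart_sup X f r + M%:E)%E b (fun x => f x + M) (M + M).
- exact: measurable_funD.
- move=> x; have := fM x; rewrite ler_norml => /andP[+ _].
  by rewrite lerNl -subr_ge0 opprK addrC.
- by move=> x; rewrite lerD2r (le_trans (ler_norm _)).
- split=> [a|]; rewrite integral_addr_cst//.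
    by rewrite leeD2r//; apply: ereal_sup_ubound; exists a => //; rewrite unlock.
  by rewrite lteD2rE.
have [h [[mh h0 [M' hM'] [K hK]] [hr hs] ch]] :=
  separating_smoothing Xac (lt0r_neq0 s_gt0) bg sg.
exists h; split=> //.
- by split=> //; exists M' => _ [x _ <-].
- exact: box_compactly_supported hK.
- move=> /(_ r s r0 s0 rs); rewrite leNgt => /negP; apply.
  apply: (@le_lt_trans _ _ (dart_sup X f r + M%:E)%E).
    by apply: ge_ereal_sup => _ [a _ <-]; rewrite unlock.
  apply: (lt_le_trans hs); apply: ereal_sup_ubound; exists b => //.
  by rewrite unlock.
Qed.
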